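(* Let $R$ be a nonzero semi-simple ring. Then $R$ is $\sqrt{\Delta}$-fine if and only if $R$ is simple.
   Context: Rings are associative with identity, not necessarily commutative. For a ring $R$, $U(R)$ is its group of units. Define $\Delta(R) = \{a \in R : 1 - ua \in U(R) \text{ for every } u \in U(R)\}$ and $\sqrt{\Delta(R)} = \{x \in R : x^m \in \Delta(R) \text{ for some integer } m \ge 1\}$. A nonzero element $r \in R$ is called $\sqrt{\Delta}$-fine if $r = u + a$ for some $u \in U(R)$ and $a \in \sqrt{\Delta(R)}$. The ring $R$ is called $\sqrt{\Delta}$-fine if every nonzero element of $R$ is $\sqrt{\Delta}$-fine. Semi-simple means semisimple Artinian, i.e. isomorphic to a finite direct product of matrix rings over division rings. *)

(* Defs.v *)
From HB Require Import structures.
From mathcomp Require Import all_boot all_order all_algebra.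

Set Implicit Arguments.
Unset Strict Implicit.
Unset Printing Implicit Defensive.

Import GRing.Theory.
Local Open Scope ring_scope.

(* Every [unitRingType] is an associative, possibly noncommutative ring with
   1 != 0, and [GRing.unit] is its set of two-sided invertible elements. *)

Definition Delta (R : unitRingType) (a : R) : Prop :=
  forall u : R, u \is a GRing.unit -> 1 - u * a \is a GRing.unit.

Definition sqrtDelta (R : unitRingType) (x : R) : Prop :=
  exists2 m : nat, (1 <= m)%N & Delta (x ^+ m).

Definition sqrtDelta_fine_elt (R : unitRingType) (r : R) : Prop :=
  r != 0 /\ exists u a : R, [/\ u \is a GRing.unit, sqrtDelta a & r = u + a].

Definition sqrtDelta_fine (R : unitRingType) : Prop :=
  forall r : R, r != 0 -> sqrtDelta_fine_elt r.

(* Despite its name, [GRing.field_axiom] does not require commutativity. *)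
Definition division_ring (D : unitRingType) : Prop := GRing.field_axiom D.

(* A ring isomorphism onto the product of the matrix rings 'M[D i]_((n i).+1) is
   given by its components [f i], which are ring morphisms because the
   operations of the product are pointwise; the bijection is the induced map
   into the product. *)
Definition semisimple_ring (R : nzRingType) : Prop :=
  exists (k : nat) (D : 'I_k -> unitRingType) (n : 'I_k -> nat)
         (f : forall i : 'I_k, {rmorphism R -> 'M[D i]_((n i).+1)}),
    (forall i : 'I_k, division_ring (D i)) /\
    bijective (fun x : R =>
      [ffun i => f i x] : {dffun forall i : 'I_k, 'M[D i]_((n i).+1)}).

Definition two_sided_ideal (R : nzRingType) (I : R -> Prop) : Prop :=
  [/\ I 0,
      forall x y : R, I x -> I y -> I (x - y),
      forall a x : R, I x -> I (a * x)
    & forall a x : R, I x -> I (x * a)].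

(* Simple rings are nonzero; here this is part of [nzRingType]. *)
Definition simple_ring (R : nzRingType) : Prop :=
  forall I : R -> Prop, two_sided_ideal I ->
    (forall x : R, I x -> x = 0) \/ (forall x : R, I x).

(* Main.v *)
Require Import Defs.
From HB Require Import structures.
From mathcomp Require Import all_boot all_order all_algebra.
From mathcomp Require Import fingroup perm.
From Stdlib Require Classical_Prop.

(** For the direct implication, let [r = u + a] be a nonzero element of a
    two-sided ideal [I].  Modulo [I], [a] equals [- u], so for [a ^+ m] in
    [Delta R] the unit [1 - (- u) ^- m * a ^+ m] belongs to [I], and [I = R].

    Conversely, a simple semisimple ring is a matrix ring over a division ring,
    and there every nonzero matrix is the sum of an invertible matrix and a
    nilpotent one, by induction on the size.  A nonzero scalar matrix is
    invertible, and any other matrix is similar to a block matrix [a b; c C]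
    whose first column [c] and lower right block [C] are both nonzero.  If
    [C = U + N] by induction, subtract the nilpotent [0 b - y; 0 N]: what
    remains, [a y; c U], is invertible as soon as the Schur complement
    [a - y U^-1 c] is nonzero, and [y] is free. *)

Set Implicit Arguments.
Unset Strict Implicit.
Unset Printing Implicit Defensive.

Import GRing.Theory.
Local Open Scope ring_scope.

(** * Sums of a unit and a nilpotent element *)

Section UnitNilpotent.
Variable S : pzRingType.
Implicit Types x y u a p q : S.

(** An explicit inverse makes sense in any [pzRingType], including matrices of size 0 or over
    noncommutative rings. *)
Definition invertible x := exists2 y, x * y = 1 & y * x = 1.

Definition unit_nilpotent x :=
  exists u a m, [/\ invertible u, a ^+ m = 0 & x = u + a].

Lemma invertibleM x y : invertible x -> invertible y -> invertible (x * y).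
Proof.
move=> [x' xx' x'x] [y' yy' y'y]; exists (y' * x').
  by rewrite mulrA -(mulrA x) yy' mulr1.
by rewrite mulrA -(mulrA y') x'x mulr1.
Qed.

Lemma unit_nilpotent_invertible x : invertible x -> unit_nilpotent x.
Proof. by move=> xI; exists x, 0, 1%N; rewrite expr1 addr0. Qed.

(** A one-sided inverse suffices for positive exponents; exponent 0 would require [p * q = 1]. *)
Lemma exprJ p q a m : q * p = 1 -> (p * a * q) ^+ m.+1 = p * a ^+ m.+1 * q.
Proof.
move=> qp; elim: m => [|m IHm]; first by rewrite !expr1.
rewrite exprS IHm (exprS a m.+1) !mulrA -(mulrA (p * a) q p) qp mulr1.
by rewrite -!mulrA.
Qed.

Lemma unit_nilpotentJ p q x : p * q = 1 -> q * p = 1 ->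
  unit_nilpotent (p * x * q) -> unit_nilpotent x.
Proof.
move=> pq qp [u [a [m [uI am0 def_x]]]].
exists (q * u * p), (q * a * p), m.+1; split.
- by apply: invertibleM; [apply: invertibleM|]; [exists p| |exists q].
- by rewrite exprJ // exprS am0 !mulr0 mul0r.
- by rewrite -mulrDl -mulrDr -def_x !mulrA qp mul1r -mulrA qp mulr1.
Qed.

End UnitNilpotent.

(** * Block matrices and the Schur complement *)

Section BlockMatrix.
Variables (S : pzRingType) (m n : nat).

Lemma mul_upper_unitri (X Y : 'M[S]_(m, n)) :
  block_mx 1%:M X 0 1%:M *m block_mx 1%:M Y 0 1%:M
  = block_mx 1%:M (X + Y) 0 1%:M.
Proof.
by rewrite mulmx_block !(mulmx1, mul1mx, mulmx0, mul0mx, addr0, add0r) addrC.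
Qed.

Lemma mul_lower_unitri (X Y : 'M[S]_(n, m)) :
  block_mx 1%:M 0 X 1%:M *m block_mx 1%:M 0 Y 1%:M
  = block_mx 1%:M 0 (X + Y) 1%:M.
Proof. by rewrite mulmx_block !(mulmx1, mul1mx, mulmx0, mul0mx, addr0, add0r). Qed.

Lemma upper_unitri_invertible (X : 'M[S]_(m, n)) :
  invertible (block_mx 1%:M X 0 1%:M : 'M_(m + n)).
Proof.
exists (block_mx 1%:M (- X) 0 1%:M); rewrite -mulmxE mul_upper_unitri.
  by rewrite subrr -scalar_mx_block.
by rewrite addNr -scalar_mx_block.
Qed.

Lemma lower_unitri_invertible (X : 'M[S]_(n, m)) :
  invertible (block_mx 1%:M 0 X 1%:M : 'M_(m + n)).
Proof.
exists (block_mx 1%:M 0 (- X) 1%:M); rewrite -mulmxE mul_lower_unitri.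
  by rewrite subrr -scalar_mx_block.
by rewrite addNr -scalar_mx_block.
Qed.

Lemma block_diag_invertible (A : 'M[S]_m) (B : 'M[S]_n) :
  invertible A -> invertible B -> invertible (block_mx A 0 0 B : 'M_(m + n)).
Proof.
move=> [A' + +] [B' + +]; rewrite -!mulmxE => AA' A'A BB' B'B.
exists (block_mx A' 0 0 B'); rewrite -mulmxE mulmx_block.
  by rewrite AA' BB' !(mulmx0, mul0mx, addr0, add0r) -scalar_mx_block.
by rewrite A'A B'B !(mulmx0, mul0mx, addr0, add0r) -scalar_mx_block.
Qed.

Lemma schur_invertible (A : 'M[S]_m) (B : 'M[S]_(m, n)) (C : 'M[S]_(n, m))
    (U V : 'M[S]_n) :
  U *m V = 1%:M -> V *m U = 1%:M -> invertible (A - B *m V *m C) ->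
  invertible (block_mx A B C U : 'M_(m + n)).
Proof.
move=> UV VU dI.
(* Block elimination with pivot [U]: the left factor clears [B], the right one clears [C]. *)
have -> : block_mx A B C U =
    (block_mx 1%:M (B *m V) 0 1%:M : 'M_(m + n))
    * block_mx (A - B *m V *m C) 0 0 U * block_mx 1%:M 0 (V *m C) 1%:M.
  rewrite -!mulmxE !mulmx_block !(mulmx1, mul1mx, mulmx0, mul0mx, addr0, add0r).
  by rewrite -(mulmxA B V U) VU mulmx1 (mulmxA U) UV mul1mx (mulmxA B V) subrK.
apply: invertibleM; last exact: lower_unitri_invertible.
apply: invertibleM; first exact: upper_unitri_invertible.
by apply: block_diag_invertible => //; exists V; rewrite -mulmxE.
Qed.

Lemma expr_block_corner0 (B : 'M[S]_(m, n)) (N : 'M[S]_n) k :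
  (block_mx 0 B 0 N : 'M_(m + n)) ^+ k.+1 = block_mx 0 (B *m N ^+ k) 0 (N ^+ k.+1).
Proof.
elim: k => [|k IHk]; first by rewrite !expr1 expr0 mulmx1.
rewrite exprSr IHk -mulmxE mulmx_block !(mulmx0, mul0mx, addr0, add0r).
by rewrite -mulmxA mulmxE -!exprSr.
Qed.

End BlockMatrix.

(** * Matrices over a division ring *)

Section DivisionRing.
Variable D : unitRingType.
Hypothesis D_div : division_ring D.

Lemma scalar_mx_invertible n (a : D) : a != 0 -> invertible (a%:M : 'M_n).
Proof.
move=> a0; have aU := D_div a0.
by exists (a^-1)%:M; rewrite -mulmxE -scalar_mxM ?divrr ?mulVr.
Qed.

Lemma unit_nilpotent_block n (a : 'M[D]_1) (b : 'rV_n) (c : 'cV_n) (C : 'M_n) :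
  c != 0 -> unit_nilpotent C -> unit_nilpotent (block_mx a b c C : 'M_(1 + n)).
Proof.
move=> c0 [U [N [k [[V UV VU] Nk0 ->]]]].
have [y dI] : exists y : 'rV_n, invertible (a - y *m V *m c).
  suff [y d0] : exists y : 'rV_n, (a - y *m V *m c) 0 0 != 0.
    by exists y; rewrite [a - _]mx11_scalar; apply: scalar_mx_invertible.
  have [a0|a0] := eqVneq (a 0 0) 0; last first.
    by exists 0; rewrite !mul0mx subr0.
  have /cV0Pn[i zi] : V *m c != 0.
    apply: contraNneq c0 => Vc0.
    by rewrite -[c]mul1mx -[1%:M]UV -mulmxE -mulmxA Vc0 mulmx0.
  (* With [a = 0], this [y] makes the Schur complement the negative of the nonzero entry [i] of
     [V *m c]. *)
  exists (delta_mx 0 i); rewrite -mulmxA -rowE !mxE a0 sub0r oppr_eq0.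
  by rewrite mxE in zi.
exists (block_mx a y c U), (block_mx 0 (b - y) 0 N), k.+1; split.
- exact: (schur_invertible UV VU dI).
- by rewrite expr_block_corner0 exprS Nk0 mulr0 mulmx0 block_mx0.
- by rewrite add_block_mx !addr0 subrKC.
Qed.

Section Step.
Variable n : nat.
Hypothesis unit_nilpotent_n : forall C : 'M[D]_n, C != 0 -> unit_nilpotent C.

Lemma unit_nilpotent_col (A : 'M[D]_(1 + n)) :
  dlsubmx A != 0 -> unit_nilpotent A.
Proof.
rewrite -[A]submxK block_mxKdl.
set a := ulsubmx A; set b := ursubmx A; set c := dlsubmx A; set C := drsubmx A.
move=> c0; have [C0|] := eqVneq C 0; last first.
  by move=> /unit_nilpotent_n; apply: unit_nilpotent_block.
have /cV0Pn[i ci] := c0.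
(* Conjugating by a unitriangular matrix replaces the zero block by [- c t]. *)
pose t : 'rV[D]_n := delta_mx 0 i.
pose P (s : 'rV[D]_n) : 'M_(1 + n) := block_mx 1%:M s 0 1%:M.
apply: (@unit_nilpotentJ _ (P t) (P (- t))).
- by rewrite -mulmxE mul_upper_unitri subrr -scalar_mx_block.
- by rewrite -mulmxE mul_upper_unitri addNr -scalar_mx_block.
rewrite -!mulmxE !mulmx_block C0 !(mulmx1, mul1mx, mulmx0, mul0mx, addr0, add0r).
apply: unit_nilpotent_block => //; apply: unit_nilpotent_n.
apply: contraNneq ci => /matrixP/(_ i i)/eqP.
by rewrite !mxE big_ord1 !mxE !eqxx mulrN mulr1 oppr_eq0.
Qed.

(** Conjugation by the transposition [s] of 0 and [j] moves the entry [(i, j)] to [(s i, 0)]. Since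
    [s i != s j = 0], it lands in the first column below the corner. *)
Lemma unit_nilpotent_offdiag (A : 'M[D]_(1 + n)) i j :
  i != j -> A i j != 0 -> unit_nilpotent A.
Proof.
move=> ij Aij; pose s := tperm ord0 j.
have ss : perm_mx s * perm_mx s = 1 :> 'M[D]_(1 + n).
  by rewrite -mulmxE -perm_mxM tperm2 perm_mx1.
apply: (@unit_nilpotentJ _ (perm_mx s) (perm_mx s)) => //.
apply: unit_nilpotent_col.
have si0 : s i != 0.
  by rewrite -[X in _ != X](tpermR ord0 j) inj_eq //; apply: perm_inj.
have [k def_k] : exists k, s i = rshift 1 k.
  by case: (@split_ordP 1 n (s i)) si0 => k -> //; [rewrite ord1 | exists k].
apply/cV0Pn; exists k; rewrite -!mulmxE -row_permE.
have -> : perm_mx s = perm_mx (s^-1)%g :> 'M[D]_(1 + n) by rewrite tpermV.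
rewrite -col_permE !mxE -def_k tpermK.
have -> : lshift n 0 = ord0 :> 'I_(1 + n) by exact: val_inj.
by rewrite /s tpermL.
Qed.

Lemma unit_nilpotent_step (A : 'M[D]_(1 + n)) : A != 0 -> unit_nilpotent A.
Proof.
move=> A0.
have [/existsP[i /existsP[j /andP[ij Aij]]]|] :=
  boolP [exists i, exists j, (i != j) && (A i j != 0)].
  exact: unit_nilpotent_offdiag Aij.
rewrite negb_exists => /forallP diagA.
have {}diagA i j : i != j -> A i j = 0.
  move=> ij; have := diagA i; rewrite negb_exists => /forallP/(_ j).
  by rewrite ij negbK => /eqP.
have [/forallP scalA|] := boolP [forall i, A i i == A 0 0].
  have defA : A = (A 0 0)%:M.
    apply/matrixP=> i j; rewrite mxE.
    by have [<-|/diagA//] := eqVneq i j; rewrite (eqP (scalA i)).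
  apply: unit_nilpotent_invertible; rewrite defA; apply: scalar_mx_invertible.
  by apply: contraNneq A0 => a0; rewrite defA a0 raddf0.
rewrite negb_forall => /existsP[i Ai].
have i0 : i != 0 by apply: contraNneq Ai => ->.
(* Here [A] is diagonal but not scalar. As [E] squares to zero, [1 + E] and [1 - E] are inverse to
   each other, and conjugating by them puts [A 0 0 - A i i] at the off-diagonal position
   [(i, 0)]. *)
pose E : 'M[D]_(1 + n) := delta_mx i 0.
have EE : E * E = 0 by rewrite -mulmxE mul_delta_mx_0 // eq_sym.
apply: (@unit_nilpotentJ _ (1 + E) (1 - E)).
- by rewrite mulrDl mul1r mulrBr mulr1 EE subr0 subrK.
- by rewrite mulrBl mul1r mulrDr mulr1 EE addr0 addrK.
apply: (unit_nilpotent_offdiag i0); rewrite mulrBr mulr1 mulrDl mul1r.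
have XE (X : 'M_(1 + n)) : (X * E) i 0 = X i i.
  rewrite -mulmxE mxE (bigD1 i) //= mxE !eqxx mulr1 big1 ?addr0 // => k /negPf ki.
  by rewrite mxE ki mulr0.
have EX k : (E * A) i k = A 0 k.
  rewrite -mulmxE mxE (bigD1 0) //= mxE !eqxx mul1r big1 ?addr0 // => l /negPf l0.
  by rewrite mxE l0 andbF mul0r.
rewrite mxE [in X in _ + X]mxE XE ![(A + _) _ _]mxE !EX.
have -> : A 0 i = 0 by rewrite diagA // eq_sym.
by rewrite (diagA i 0) // addr0 add0r subr_eq0 eq_sym.
Qed.

End Step.

Lemma matrix_unit_nilpotent n (A : 'M[D]_n) : A != 0 -> unit_nilpotent A.
Proof.
elim: n A => [A|n IHn]; first by rewrite flatmx0 eqxx.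
exact: unit_nilpotent_step.
Qed.

End DivisionRing.

(** * Fine rings, simple rings and the equivalence *)

Lemma sqrtDelta_nilpotent (R : unitRingType) (a : R) m :
  a ^+ m = 0 -> sqrtDelta a.
Proof.
move=> am0; exists m.+1 => // u _.
by rewrite exprS am0 !mulr0 subr0 unitr1.
Qed.

Lemma sqrtDelta_fine_simple (R : unitRingType) :
  sqrtDelta_fine R -> simple_ring R.
Proof.
move=> fineR I [I0 IB Il Ir].
have [[r Irr r0]|noI] := Classical_Prop.classic (exists2 r, I r & r != 0);
  last first.
  by left=> x Ix; apply: contra_not_eq noI; exists x.
right; have [_ [u [a [uU [m m_gt0 am] def_r]]]] := fineR r r0.
have IN x : I x -> I (- x) by move=> Ix; rewrite -sub0r; apply: IB.
have ID x y : I x -> I y -> I (x + y).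
  by move=> Ix Iy; rewrite -[y]opprK; apply/IB/IN.
have Ipow k : I (a ^+ k - (- u) ^+ k).
  (* Powers stay congruent modulo [I] because [a - (- u) = r] lies in [I]. *)
  elim: k => [|k IHk]; first by rewrite subrr.
  have -> : a ^+ k.+1 - (- u) ^+ k.+1
      = a * (a ^+ k - (- u) ^+ k) + r * (- u) ^+ k.
    by rewrite def_r !exprS mulrBr mulrDl mulNr opprK [u * _ + _]addrC addrA subrK.
  by apply: ID; [apply: Il | apply: Ir].
have uNm : (- u) ^+ m \is a GRing.unit by rewrite unitrX // unitrN.
set w := 1 - (- u) ^- m * a ^+ m.
have wU : w \is a GRing.unit by apply: am; rewrite unitrV.
have Iw : I w.
  by rewrite /w -(mulVr uNm) -mulrBr; apply: Il; rewrite -opprB; apply: IN.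
by move=> x; rewrite -[x]mulr1 -(mulVr wU) mulrA; apply: Il.
Qed.

(** The first component has a proper kernel, which simplicity makes zero. It is onto because a
    matrix lifts to the product with zeros in the other factors. *)
Lemma simple_semisimple_matrix (R : nzRingType) :
  semisimple_ring R -> simple_ring R ->
  exists (D : unitRingType) (n : nat) (f : {rmorphism R -> 'M[D]_n.+1}),
    division_ring D /\ bijective f.
Proof.
move=> [[|k] [D [n [f [Ddiv [g fK gK]]]]]] simR.
  (* The empty product has a single element, whereas [1 != 0] in [R]. *)
  have /eqP[] := oner_neq0 R; apply: (can_inj fK).
  by apply/ffunP=> -[].
exists (D ord0), (n ord0), (f ord0); split=> //.
pose lift_mx (M : 'M[D ord0]_((n ord0).+1)) :
    {dffun forall i, 'M[D i]_((n i).+1)} :=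
  [ffun i => dfwith (fun i => 0 : 'M[D i]_((n i).+1)) M i].
have fg : cancel (g \o lift_mx) (f ord0).
  by move=> M; move: (gK (lift_mx M)) => /ffunP/(_ ord0); rewrite !ffunE dfwith_in.
have kerI : two_sided_ideal (fun x => f ord0 x = 0).
  split=> [|x y x0 y0|a x x0|a x x0]; rewrite ?rmorph0 //.
  - by rewrite rmorphB x0 y0 subr0.
  - by rewrite rmorphM x0 mulr0.
  - by rewrite rmorphM x0 mul0r.
have [ker0|/(_ 1)/eqP] := simR _ kerI; last by rewrite rmorph1 oner_eq0.
exists (g \o lift_mx) => // x.
by apply/subr0_eq/ker0; rewrite rmorphB fg subrr.
Qed.

Theorem lemma3p12 (R : unitRingType) (hR : semisimple_ring R) :
  sqrtDelta_fine R <-> simple_ring R.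
Proof.
split=> [|simR]; first exact: sqrtDelta_fine_simple.
have [D [n [f [Ddiv [g fK gK]]]]] := simple_semisimple_matrix hR simR.
move=> r r0; split=> //.
have fr0 : f r != 0.
  by apply: contraNneq r0 => fr0; rewrite -[r]fK fr0 -(rmorph0 f) fK.
have [u [a [m [[v uv vu] am0 frE]]]] := matrix_unit_nilpotent Ddiv fr0.
(* [g] is given only as an inverse map, so every identity is checked after applying the injective
   morphism [f]. *)
exists (g u), (g a); have fI := can_inj fK; split.
- by apply/unitrP; exists (g v); split; apply: fI; rewrite rmorphM rmorph1 !gK.
- by apply: (@sqrtDelta_nilpotent _ _ m); apply: fI; rewrite rmorphXn rmorph0 gK.
- by apply: fI; rewrite rmorphD !gK.
Qed.
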